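(* Let $A$ be a Zinbiel algebra over $F$ with a derivation $D$. Then $A$ with respect to the product $a\star b= D(a) b-a D(b)$ is a left-symmetric algebra, that is, for all $a,b,c\in A$, $$(a\star b)\star c -a\star (b\star c)=(b\star a)\star c -b\star (a\star c).$$
   Context: The base field $F$ is algebraically closed of characteristic $0$. A Zinbiel algebra is a vector space $A$ with a bilinear product $(a,b)\mapsto ab$ satisfying $(ab+ba)c=a(bc)$ for all $a,b,c\in A$. A derivation of $A$ is a linear map $D:A\to A$ with $D(ab)=D(a)b+aD(b)$ for all $a,b\in A$. *)

(* Defs.v *)
From HB Require Import structures.
From mathcomp Require Import all_boot all_order all_algebra.

Set Implicit Arguments.
Unset Strict Implicit.
Unset Printing Implicit Defensive.

Import GRing.Theory.
Local Open Scope ring_scope.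

(* An algebra is a vector space A (of arbitrary dimension) together with a    *)
(* bilinear product, given as a curried function; MathComp's algType is not   *)
(* applicable because neither associativity nor a unit is assumed.            *)
Definition is_algebra (F : fieldType) (A : lmodType F) (mul : A -> A -> A) :=
  bilinear_for *:%R *:%R mul.

Definition zinbiel_algebra (F : fieldType) (A : lmodType F)
    (mul : A -> A -> A) : Prop :=
  is_algebra mul /\
  forall a b c : A, mul (mul a b + mul b a) c = mul a (mul b c).

Definition derivation (F : fieldType) (A : lmodType F)
    (mul : A -> A -> A) (D : A -> A) : Prop :=
  linear D /\
  forall a b : A, D (mul a b) = mul (D a) b + mul a (D b).

Definition left_symmetric_algebra (F : fieldType) (A : lmodType F)
    (mul : A -> A -> A) : Prop :=
  is_algebra mul /\
  forall a b c : A,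
    mul (mul a b) c - mul a (mul b c) = mul (mul b a) c - mul b (mul a c).

Definition star (F : fieldType) (A : lmodType F)
    (mul : A -> A -> A) (D : A -> A) (a b : A) : A :=
  mul (D a) b - mul a (D b).

(* Main.v *)
Require Import Defs.
From mathcomp Require Import all_boot all_order all_algebra.

(** Write [a'] for [D a], [L x] for left multiplication by [x], and
    [{x, y} = x y + y x].  The Zinbiel identity says [L x (L y c) = {x, y} c];
    its left-hand factor [{x, y}] is symmetric, so left multiplications commute
    and [L {x, y} = L x L y] (lemma [zinbiel_left_comm]).

    Left-symmetry of [star] is equivalent to
    [[a, b] * c = a * (b * c) - b * (a * c)], where [*] is [star] and
    [[a, b] = a * b - b * a = {a', b} - {a, b'}].  Since the mixed terms
    [a' b'] cancel when [D] is applied to [a * b] ([derivation_star]), also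
    [[a, b]' = {a'', b} - {a, b''}].  The Zinbiel identity then gives
    [[a, b] * c = (a'' (b c) + b' (a c')) - (a (b'' c) + a' (b c'))]
    ([star_commutator_left]).  On the other side
    [a * (b * c) = (a' (b' c) + a (b c'')) - (a (b'' c) + a' (b c'))]
    ([star_star_right]).  The terms of the first bracket are symmetric in [a]
    and [b] because left multiplications commute, so they disappear on
    exchanging [a] and [b] and subtracting, and the rest is [[a, b] * c]. *)

Set Implicit Arguments.
Unset Strict Implicit.
Unset Printing Implicit Defensive.

Import GRing.Theory.
Local Open Scope ring_scope.

(** * Products and derivations of algebras *)

Section Algebra.

Variables (F : fieldType) (A : lmodType F) (mul : A -> A -> A) (D : A -> A).
Hypothesis algA : is_algebra mul.

Lemma algebra_mulDl a b c : mul (a + b) c = mul a c + mul b c.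
Proof. by have := algA.1 c 1 a b; rewrite /= !scale1r. Qed.

Lemma algebra_mulDr a b c : mul a (b + c) = mul a b + mul a c.
Proof. by have := algA.2 a 1 b c; rewrite /= !scale1r. Qed.

Lemma algebra_mulBl a b c : mul (a - b) c = mul a c - mul b c.
Proof. by have := algA.1 c (-1) b a; rewrite /= !scaleN1r ![- _ + _]addrC. Qed.

Lemma algebra_mulBr a b c : mul a (b - c) = mul a b - mul a c.
Proof. by have := algA.2 a (-1) c b; rewrite /= !scaleN1r ![- _ + _]addrC. Qed.

Lemma star_is_algebra : linear D -> is_algebra (star mul D).
Proof.
move=> linD; split=> [c|a] k x y; rewrite /star /= linD.
- by rewrite (algA.1 c) (algA.1 (D c)) /= opprD addrACA -scalerBr.
- by rewrite (algA.2 (D a)) (algA.2 a) /= opprD addrACA -scalerBr.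
Qed.

Hypothesis derD : derivation mul D.

Lemma derivationB a b : D (a - b) = D a - D b.
Proof. by have := derD.1 (-1) b a; rewrite !scaleN1r ![- _ + _]addrC. Qed.

(** The mixed terms [mul (D a) (D b)] cancel, so [D] creates no new kind of
    product. *)
Lemma derivation_star a b :
  D (star mul D a b) = mul (D (D a)) b - mul a (D (D b)).
Proof. by rewrite /star derivationB !derD.2 opprD addrA addrK. Qed.

Lemma star_star_right a b c :
  star mul D a (star mul D b c) =
    (mul (D a) (mul (D b) c) + mul a (mul b (D (D c))))
    - (mul a (mul (D (D b)) c) + mul (D a) (mul b (D c))).
Proof.
rewrite {1}/star derivation_star /star !algebra_mulBr.
by rewrite opprB addrACA -opprD [X in _ - X]addrC.
Qed.

End Algebra.

(** * The product a * b = D(a) b - a D(b) on a Zinbiel algebra *)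

Section Zinbiel.

Variables (F : fieldType) (A : lmodType F) (mul : A -> A -> A) (D : A -> A).
Hypothesis zinbielA : zinbiel_algebra mul.

Lemma zinbiel_left_comm a b c : mul a (mul b c) = mul b (mul a c).
Proof. by rewrite -!zinbielA.2 addrC. Qed.

Hypothesis derD : derivation mul D.

Lemma star_commutator a b :
  star mul D a b - star mul D b a =
    (mul (D a) b + mul b (D a)) - (mul a (D b) + mul (D b) a).
Proof. by rewrite /star opprB addrACA -opprD. Qed.

(** The commutator of [star] and its image by [D] are both differences of
    anticommutators of [mul], the only left factors on which the Zinbiel
    identity acts; this is why the commutator is kept whole. *)
Lemma star_commutator_left a b c :
  star mul D (star mul D a b - star mul D b a) c =
    (mul (D (D a)) (mul b c) + mul (D b) (mul a (D c)))
    - (mul a (mul (D (D b)) c) + mul (D a) (mul b (D c))).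
Proof.
have algA := zinbielA.1.
have DE : D (star mul D a b - star mul D b a) =
    (mul (D (D a)) b + mul b (D (D a))) - (mul a (D (D b)) + mul (D (D b)) a).
  by rewrite (derivationB derD) !derivation_star // opprB addrACA -opprD.
rewrite {1}/star DE star_commutator !(algebra_mulBl algA) !zinbielA.2.
by rewrite opprB addrACA -opprD [mul a (mul (D b) _)]zinbiel_left_comm.
Qed.

Lemma zinbiel_star_left_symmetric : left_symmetric_algebra (star mul D).
Proof.
have starA := star_is_algebra zinbielA.1 derD.1; split=> // a b c.
(* This puts both products by c on the same side, as a commutator. *)
have swap (u v l r : A) : u - v = l - r -> u - l = v - r.
  by move=> /(canRL (subrK _)) ->; rewrite addrC -addrA addKr addrC.
apply: swap; rewrite -(algebra_mulBl starA).
rewrite star_commutator_left !(star_star_right zinbielA.1 derD).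
rewrite [mul (D b) (mul (D a) _)]zinbiel_left_comm.
rewrite [mul b (mul a (D _))]zinbiel_left_comm.
rewrite [mul b (mul (D _) _)]zinbiel_left_comm.
by rewrite opprB [RHS]addrC subrKA.
Qed.

End Zinbiel.

Theorem proposition2p3 (F : closedFieldType) (char0 : [pchar F] =i pred0)
    (A : lmodType F) (mul : A -> A -> A) (D : A -> A)
    (zinbielA : zinbiel_algebra mul) (derD : derivation mul D) :
  left_symmetric_algebra (star mul D).
Proof. exact: zinbiel_star_left_symmetric. Qed.
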